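(* For $n\in\mathbb{N}$ and a symmetric matrix $W=(w_{ij})\in\mathbb{R}^{n\times n}$ with $w_{ij}\ge 0$ and $w_{ii}=0$, consider the maximum cut game $$\nu_W(u)=\max_{x\in\{0,1\}^n}\left[\sum_{i<j}w_{ij}(x_i+x_j-2x_ix_j):\ x\le u\right],\qquad u\in\{0,1\}^n.$$ The smallest $\gamma\ge 1$ such that the $\gamma$-core of every maximum cut game is non-empty is $4$; that is, the $4$-core of $\nu_W$ is non-empty for every such $n$ and $W$, and for every $1\le\gamma<4$ there exist $n$ and $W$ such that the $\gamma$-core of $\nu_W$ is empty.
   Context: For $\gamma\ge 1$, the $\gamma$-core of a game $\nu:\{0,1\}^n\to\mathbb{R}$ is $\{y\in\mathbb{R}^n:\ \mathbf{1}_n^Ty\le\gamma\,\nu(\mathbf{1}_n),\ a^Ty\ge\nu(a)\ \forall a\in\{0,1\}^n\}$, where $\mathbf{1}_n$ is the all-one vector. Vector inequalities are componentwise. *)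

(* Defs.v *)
From mathcomp Require Import all_boot all_order all_algebra.
From mathcomp Require Import boolp classical_sets reals.

Set Implicit Arguments.
Unset Strict Implicit.
Unset Printing Implicit Defensive.

Import Order.TTheory GRing.Theory Num.Theory.
Local Open Scope classical_set_scope.
Local Open Scope ring_scope.

Definition binvec (n : nat) := {ffun 'I_n -> bool}.

Definition ones (n : nat) : binvec n := [ffun=> true].

Definition lebin (n : nat) (x u : binvec n) : bool :=
  [forall i, (x i <= u i)%N].

Definition bindot (R : realType) (n : nat) (a : binvec n) (y : 'cV[R]_n) : R :=
  \sum_(i < n) (a i)%:R * y i 0.

Definition game (R : realType) (n : nat) := binvec n -> R.

Definition gamma_core (R : realType) (n : nat) (gamma : R) (nu : game R n) :
    set 'cV[R]_n :=
  [set y | bindot (ones n) y <= gamma * nu (ones n) /\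
           forall a : binvec n, nu a <= bindot a y].

Definition cut_value (R : realType) (n : nat) (W : 'M[R]_n) (x : binvec n) : R :=
  \sum_(i < n) \sum_(j < n | (i < j)%N)
    W i j * ((x i)%:R + (x j)%:R - 2 * (x i)%:R * (x j)%:R).

(* The default of the iterated maximum is the value at x := u, which is
   feasible, so this is the maximum over {x | x <= u} itself. *)
Definition maxcut_game (R : realType) (n : nat) (W : 'M[R]_n) : game R n :=
  fun u => \big[Num.max/cut_value W u]_(x : binvec n | lebin x u) cut_value W x.

Definition cut_weights (R : realType) (n : nat) (W : 'M[R]_n) : Prop :=
  [/\ W^T = W, forall i j, 0 <= W i j & forall i, W i i = 0].

(* Main.v *)
Require Import Defs.
From mathcomp Require Import all_boot all_order all_algebra.
From mathcomp Require Import boolp classical_sets reals.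
From mathcomp Require Import ring lra.

Set Implicit Arguments.
Unset Strict Implicit.
Unset Printing Implicit Defensive.

Import Order.TTheory GRing.Theory Num.Theory.
Local Open Scope classical_set_scope.
Local Open Scope ring_scope.

(** Let [T] be the total weight of the edges [i < j].

    Upper bound.  The vector of weighted degrees lies in the 4-core.  A cut
    selected by [x <= u] weighs at most the sum of the degrees over [x], hence
    over [u] ([cut_value_le_degree]).  The degrees sum to [2 T], and
    [T <= 2 * maxcut] because a uniformly random vertex set cuts each edge with
    probability one half ([total_weight_le_maxcut]).

    Lower bound.  In the complete graph on [n] vertices with unit weights, a cut
    with [s] vertices on one side weighs [s * (n - s)] ([cut_value_complete]).
    So each single vertex forces [y i >= n - 1], while the maximum cut is at
    most [n^2 / 4].  A point of the [gamma]-core thus gives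
    [n * (n - 1) <= gamma * n^2 / 4], that is [n * (4 - gamma) <= 4] if [n > 0];
    this fails for large [n] when [gamma < 4]. *)

Lemma sum_sym_lt (V : nmodType) (n : nat) (F : 'I_n -> 'I_n -> V) :
  (forall i j, F i j = F j i) -> (forall i, F i i = 0) ->
  \sum_i \sum_j F i j = (\sum_(i < n) \sum_(j < n | (i < j)%N) F i j) *+ 2.
Proof.
move=> Fsym F0; rewrite mulr2n.
transitivity (\sum_(i < n) (\sum_(j < n | (i < j)%N) F i j +
                            \sum_(j < n | (j < i)%N) F i j)).
  apply: eq_bigr => i _; rewrite (bigID (fun j : 'I_n => (i < j)%N)) /=.
  congr (_ + _); rewrite (bigD1 i) ?ltnn //= F0 add0r.
  by apply: eq_bigl => j; rewrite -leqNgt ltn_neqAle andbC.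
rewrite big_split /=; congr (_ + _).
rewrite (exchange_big_dep xpredT) //=.
by apply: eq_bigr => i _; apply: eq_bigr => j _; rewrite Fsym.
Qed.

Section MaxCut.
Variables (R : realType) (n : nat).
Implicit Types (W : 'M[R]_n) (x u : binvec n) (i j : 'I_n).

(** The sum of the weights of all edges, each edge [i < j] counted once. *)
Definition total_weight W : R := \sum_(i < n) \sum_(j < n | (i < j)%N) W i j.

(** The column vector of weighted degrees. *)
Definition degree W : 'cV[R]_n := \col_i \sum_j W i j.

Lemma cut_weights_sym W i j : cut_weights W -> W i j = W j i.
Proof. by case=> WT _ _; rewrite -[in LHS]WT mxE. Qed.

Lemma maxcut_game_ge W u x : lebin x u -> cut_value W x <= maxcut_game W u.
Proof. by move=> xu; apply: le_bigmax_cond. Qed.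

Lemma maxcut_game_le W u (M : R) :
  (forall x, lebin x u -> cut_value W x <= M) -> maxcut_game W u <= M.
Proof.
move=> H; apply: bigmax_le => //; apply: H.
by apply/forallP => i.
Qed.

Lemma lebin_ones x : lebin x (ones n).
Proof. by apply/forallP => i; rewrite ffunE; case: (x i). Qed.

(** Summing over ordered pairs counts each edge twice. *)
Lemma cut_value_symE W x : cut_weights W ->
  cut_value W x *+ 2 =
  \sum_i \sum_j W i j * ((x i)%:R + (x j)%:R - 2 * (x i)%:R * (x j)%:R).
Proof.
move=> cW; rewrite sum_sym_lt // => [i j|i].
  by rewrite (cut_weights_sym i j cW); ring.
by case: cW => _ _ ->; rewrite mul0r.
Qed.

Lemma sum_degree W : cut_weights W ->
  bindot (ones n) (degree W) = total_weight W *+ 2.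
Proof.
move=> cW; rewrite -sum_sym_lt => [|i j|i].
- by apply: eq_bigr => i _; rewrite ffunE mul1r mxE.
- exact: cut_weights_sym.
- by case: cW.
Qed.

Lemma cut_value_le_degree W x : cut_weights W ->
  cut_value W x <= bindot x (degree W).
Proof.
move=> cW; have [_ W0 _] := cW.
rewrite -(ler_pMn2r (ltn0Sn 1)) cut_value_symE //.
have -> : bindot x (degree W) = \sum_i \sum_j W i j * (x i)%:R.
  by apply: eq_bigr => i _; rewrite mxE mulrC mulr_suml.
rewrite [leRHS]mulr2n [X in _ <= _ + X]exchange_big /= -big_split /=.
apply: ler_sum => i _; rewrite -big_split /=; apply: ler_sum => j _.
rewrite (cut_weights_sym j i cW) -mulrDr; apply: ler_wpM2l => //.
by rewrite gerDl oppr_le0 !mulr_ge0 ?ler0n.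
Qed.

Lemma bindot_mono x u (y : 'cV[R]_n) : (forall i, 0 <= y i 0) -> lebin x u ->
  bindot x y <= bindot u y.
Proof.
move=> y0 /forallP xu; apply: ler_sum => i _; apply: ler_wpM2r => //.
by rewrite ler_nat.
Qed.

(** The vertex set [x] with the membership of [i] toggled. *)
Definition flip i x : binvec n := [ffun k => (k == i) (+) x k].

Lemma flipK i : involutive (flip i).
Proof. by move=> x; apply/ffunP => k; rewrite !ffunE addbA addbb. Qed.

(** Toggling [i] toggles whether the edge [i j] is cut, so exactly half of all
    vertex sets cut it. *)
Lemma sum_cut_edge i j : i != j ->
  (\sum_(x : binvec n) ((x i)%:R + (x j)%:R - 2 * (x i)%:R * (x j)%:R)) *+ 2
  = #|{: binvec n}|%:R :> R.
Proof.
move=> ij; rewrite mulr2n [X in _ + X](reindex_inj (inv_inj (flipK i))) /=.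
rewrite -big_split /= -sum1_card natr_sum; apply: eq_bigr => x _.
rewrite !ffunE eqxx eq_sym (negbTE ij) /=.
by case: (x i); case: (x j) => /=; ring.
Qed.

Lemma total_weight_le_maxcut W :
  total_weight W <= maxcut_game W (ones n) *+ 2.
Proof.
have N0 : (0 : R) < #|{: binvec n}|%:R.
  by rewrite ltr0n; apply/card_gt0P; exists (ones n).
rewrite -(ler_pM2l N0).
have -> : #|{: binvec n}|%:R * total_weight W =
          (\sum_(x : binvec n) cut_value W x) *+ 2.
  rewrite /cut_value exchange_big /= -sumrMnl mulr_sumr.
  apply: eq_bigr => i _; rewrite exchange_big /= -sumrMnl mulr_sumr.
  apply: eq_bigr => j ij; rewrite -mulr_sumr -mulrnAr sum_cut_edge 1?mulrC //.
  by rewrite neq_ltn ij.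
rewrite [leRHS]mulrnAr lerMn2r /= mulr_natl -sumr_const.
by apply: ler_sum => x _; apply/maxcut_game_ge/lebin_ones.
Qed.

Lemma degree_in_core W : cut_weights W ->
  gamma_core 4 (maxcut_game W) (degree W).
Proof.
move=> cW; split=> [|u].
  rewrite sum_degree // (_ : 4 * _ = (maxcut_game W (ones n) *+ 2) *+ 2).
    by rewrite lerMn2r total_weight_le_maxcut.
  by rewrite -mulrnA mulr_natl.
apply: maxcut_game_le => x xu.
apply: le_trans (cut_value_le_degree x cW) _; apply: bindot_mono => // i.
by rewrite mxE; apply: sumr_ge0 => j _; case: cW.
Qed.

(** The weights of the complete graph: 1 off the diagonal, 0 on it. *)
Definition complete_weights : 'M[R]_n := \matrix_(i, j) (i != j)%:R.

Lemma complete_cut_weights : cut_weights complete_weights.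
Proof.
split=> [|i j|i]; last by rewrite mxE eqxx.
  by apply/matrixP => i j; rewrite !mxE eq_sym.
by rewrite mxE.
Qed.

Lemma cut_value_complete x : cut_value complete_weights x =
  (\sum_i (x i)%:R) * (n%:R - \sum_i (x i)%:R).
Proof.
apply: (pmulrnI (ltn0Sn 1)) => /=.
rewrite cut_value_symE; last exact: complete_cut_weights.
set s : R := \sum_i (x i)%:R.
transitivity (\sum_i (n%:R * (x i)%:R + s - 2 * (x i)%:R * s)).
  apply: eq_bigr => i _.
  transitivity (\sum_j ((x i)%:R + (x j)%:R - 2 * (x i)%:R * (x j)%:R : R)).
    apply: eq_bigr => j _; rewrite mxE.
    (* On the diagonal the second factor vanishes too, as [x j] is 0 or 1. *)
    case: eqVneq => [->|_]; last by rewrite mul1r.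
    by case: (x j) => /=; ring.
  by rewrite sumrB big_split /= sumr_const card_ord -mulr_sumr -[_ *+ n]mulr_natl.
rewrite sumrB big_split /= sumr_const card_ord -mulr_sumr -mulr_suml -mulr_sumr.
by rewrite -/s -[s *+ n]mulr_natl; ring.
Qed.

Lemma maxcut_complete_le : maxcut_game complete_weights (ones n) <= n%:R ^+ 2 / 4.
Proof.
apply: maxcut_game_le => x _; rewrite cut_value_complete.
set s := \sum_i _.
by have := sqr_ge0 (n%:R - 2 * s); nra.
Qed.

Lemma complete_core_ge (y : 'cV[R]_n) i :
  (forall a, maxcut_game complete_weights a <= bindot a y) -> n%:R - 1 <= y i 0.
Proof.
move=> /(_ [ffun k => k == i]); set e : binvec n := finfun _ => ye.
(* [e] is the indicator of the single vertex [i]. *)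
have se (f : 'I_n -> R) : \sum_k (e k)%:R * f k = f i.
  rewrite (bigD1 i) //= big1 ?ffunE ?eqxx ?mul1r ?addr0 // => k /negbTE ki.
  by rewrite ffunE ki mul0r.
have s1 : \sum_k (e k)%:R = 1 :> R.
  by rewrite -[RHS](se (fun=> 1)); apply: eq_bigr => k _; rewrite mulr1.
have ee : lebin e e by apply/forallP => k.
have := le_trans (maxcut_game_ge _ ee) ye.
by rewrite cut_value_complete s1 mul1r /bindot se.
Qed.

Lemma complete_core_bound (gamma : R) : 0 <= gamma -> (0 < n)%N ->
  gamma_core gamma (maxcut_game complete_weights) !=set0 ->
  n%:R * (4 - gamma) <= 4.
Proof.
move=> g0 n0 [y [y1 ya]].
have nR : (0 : R) < n%:R by rewrite ltr0n.
have lo : n%:R * (n%:R - 1) <= bindot (ones n) y.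
  rewrite mulr_natl -[n in _ *+ n]card_ord -sumr_const.
  by apply: ler_sum => i _; rewrite ffunE mul1r; apply: complete_core_ge.
have hi := ler_wpM2l g0 maxcut_complete_le.
have := le_trans lo (le_trans y1 hi).
rewrite -(ler_pM2l nR); nra.
Qed.

End MaxCut.

Theorem fact1 (R : realType) :
  (forall (n : nat) (W : 'M[R]_n), cut_weights W ->
     gamma_core 4 (maxcut_game W) !=set0) /\
  (forall gamma : R, 1 <= gamma -> gamma < 4 ->
     exists (n : nat) (W : 'M[R]_n),
       cut_weights W /\ gamma_core gamma (maxcut_game W) = set0).
Proof.
split=> [n W cW|gamma g1 g4]; first by exists (degree W); apply: degree_in_core.
have d0 : 0 < 4 - gamma by rewrite subr_gt0.
have b0 : 0 <= 4 / (4 - gamma) by rewrite divr_ge0 // ltW.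
have nb := archi_boundP b0; set n := Num.bound _ in nb.
have n0 : (0 < n)%N by rewrite -(ltr0n R); apply: le_lt_trans nb.
exists n, (complete_weights R n); split; first exact: complete_cut_weights.
apply: contrapT => /eqP/set0P /(complete_core_bound (le_trans ler01 g1) n0).
by apply/negP; rewrite -ltNge -ltr_pdivrMr.
Qed.
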